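(* Let $P_1,\dots,P_5\in\mathbb{P}^2_{\mathbb{C}}$ be a $V$-configuration. Then: \begin{enumerate} \item $8\le \operatorname{rk}\Phi(P_1,\dots,P_5)\le 10$. \item $\operatorname{rk}\Phi(P_1,\dots,P_5)\le 9$ if and only if $\delta_1(P_1,P_2,P_4)\cdot\delta_2(P_1,\dots,P_5)=0$. \item $\operatorname{rk}\Phi(P_1,\dots,P_5)=8$ if and only if one of the following holds: (a) $\delta_1(P_1,P_2,P_4)=0$, $\overline{\delta}_1(P_1,P_2,P_3)=0$ and $\overline{\delta}_1(P_1,P_4,P_5)=0$; or (b) the line $P_1\vee P_2$ is tangent to $\mathcal{Q}_{\mathrm{iso}}$ at $P_2$ or $P_3$, and the line $P_1\vee P_4$ is tangent to $\mathcal{Q}_{\mathrm{iso}}$ at $P_4$ or $P_5$; moreover, in this case $\delta_1(P_1,P_2,P_4)\neq 0$. In particular, in both cases (a) and (b) one has $\delta_2(P_1,P_2,P_3,P_4,P_5)=0$. \end{enumerate}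
   Context: Work in $\mathbb{P}^2_{\mathbb{C}}$. $P\vee Q$ is the line through distinct points $P,Q$. $\mathcal{Q}_{\mathrm{iso}}$ is the conic $x^2+y^2+z^2=0$ and $\langle\cdot,\cdot\rangle$ is the associated bilinear form $\langle (A,B,C),(A',B',C')\rangle=AA'+BB'+CC'$. For points $P_i,P_j$ (with chosen representing vectors) put $s_{ij}=\langle P_i,P_j\rangle$. Vanishing of the expressions below does not depend on the chosen representatives. For a ternary cubic form $f$ over $\mathbb{C}$ let $g_1=x\partial_yf-y\partial_xf$, $g_2=x\partial_zf-z\partial_xf$, $g_3=y\partial_zf-z\partial_yf$. For a point $P=(A:B:C)$, $\Phi(P)$ is the $3\times10$ matrix (depending on $A,B,C$) such that $\Phi(P)\,w_f=(g_1(P),g_2(P),g_3(P))^{T}$ for every cubic $f$, where $w_f\in\mathbb{C}^{10}$ is the vector of coefficients of $f$ in the monomial basis $x^3,x^2y,xy^2,y^3,x^2z,xyz,y^2z,xz^2,yz^2,z^3$. $\Phi(P_1,\dots,P_n)$ is the $3n\times 10$ matrix obtained by stacking $\Phi(P_1),\dots,\Phi(P_n)$. A $V$-configuration is a tuple of five distinct points $P_1,\dots,P_5$ of the plane such that $P_1,P_2,P_3$ are aligned, $P_1,P_4,P_5$ are aligned, and $P_1,P_2,P_4$ are not aligned. Define $\delta_1(P_1,P_2,P_4)=s_{11}s_{24}-s_{12}s_{14}$; $\overline{\delta}_1(P_1,P_i,P_j)=s_{11}s_{ij}+s_{1i}s_{1j}$ for distinct aligned $P_1,P_i,P_j$; and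 $\delta_2(P_1,\dots,P_5)=s_{12}s_{13}s_{45}-s_{14}s_{15}s_{23}$. *)

(* Defs.v *)
From HB Require Import structures.
From mathcomp Require Import all_boot all_order all_algebra.
From mathcomp Require Export reals.
From mathcomp Require Import ring.
From mathcomp Require Export complex mpoly.

Set Implicit Arguments.
Unset Strict Implicit.
Unset Printing Implicit Defensive.

Import GRing.Theory.

Local Open Scope ring_scope.

(* Projective plane over a field K.  A point is given by a representing vector,
   i.e. a nonzero u : 'rV[K]_3, and u, v represent the same point iff they span
   the same line of K^3: (u == v)%MS.  A projective line is given by a matrix
   whose row space is the corresponding 2-dimensional subspace of K^3, so that
   incidence is (P <= L)%MS and equality of lines is (L == M)%MS. *)

Definition is_point (K : fieldType) (P : 'rV[K]_3) : bool := P != 0.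

Definition same_point (K : fieldType) (P Q : 'rV[K]_3) : bool := (P == Q)%MS.

Definition is_line (K : fieldType) (L : 'M[K]_3) : bool := \rank L == 2%N.

Definition aligned (K : fieldType) (P Q S : 'rV[K]_3) : Prop :=
  exists L : 'M[K]_3,
    is_line L /\ [/\ (P <= L)%MS, (Q <= L)%MS & (S <= L)%MS].

Definition join_line (K : fieldType) (P Q : 'rV[K]_3) : 'M[K]_3 := (P + Q)%MS.

Definition ix : 'I_3 := @Ordinal 3%N 0%N isT.
Definition iy : 'I_3 := @Ordinal 3%N 1%N isT.
Definition iz : 'I_3 := @Ordinal 3%N 2%N isT.

Definition evalp (K : fieldType) (f : {mpoly K[3]}) (P : 'rV[K]_3) : K :=
  f.@[P 0].

(* The projective tangent line at P to the curve f = 0: the vectors orthogonal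
   to the gradient of f at P.  It is a line when P is a smooth point. *)
Definition tangent_line (K : fieldType) (f : {mpoly K[3]}) (P : 'rV[K]_3) :
    'M[K]_3 :=
  kermx (\col_(i < 3) evalp f^`M(i) P).

Definition tangent_at (K : fieldType) (L : 'M[K]_3) (f : {mpoly K[3]})
    (P : 'rV[K]_3) : Prop :=
  [/\ is_line L, evalp f P = 0 & (L == tangent_line f P)%MS].

Definition Qiso (K : fieldType) : {mpoly K[3]} :=
  'X_ix ^+ 2 + 'X_iy ^+ 2 + 'X_iz ^+ 2.

Definition tangent_Qiso (K : fieldType) (L : 'M[K]_3) (P : 'rV[K]_3) : Prop :=
  tangent_at L (Qiso K) P.

Definition bil (K : fieldType) (P Q : 'rV[K]_3) : K :=
  P 0 ix * Q 0 ix + P 0 iy * Q 0 iy + P 0 iz * Q 0 iz.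

Definition V_configuration (K : fieldType) (P1 P2 P3 P4 P5 : 'rV[K]_3) : Prop :=
  [/\ all (@is_point K) [:: P1; P2; P3; P4; P5],
      pairwise (fun P Q => ~~ same_point P Q) [:: P1; P2; P3; P4; P5],
      aligned P1 P2 P3, aligned P1 P4 P5 & ~ aligned P1 P2 P4].

Definition delta1 (K : fieldType) (P1 P2 P4 : 'rV[K]_3) : K :=
  bil P1 P1 * bil P2 P4 - bil P1 P2 * bil P1 P4.

Definition delta1bar (K : fieldType) (P1 Pi Pj : 'rV[K]_3) : K :=
  bil P1 P1 * bil Pi Pj + bil P1 Pi * bil P1 Pj.

Definition delta2 (K : fieldType) (P1 P2 P3 P4 P5 : 'rV[K]_3) : K :=
  bil P1 P2 * bil P1 P3 * bil P4 P5 - bil P1 P4 * bil P1 P5 * bil P2 P3.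

Definition gpolys (K : fieldType) (f : {mpoly K[3]}) :
    3.-tuple {mpoly K[3]} :=
  [tuple 'X_ix * f^`M(iy) - 'X_iy * f^`M(ix);
         'X_ix * f^`M(iz) - 'X_iz * f^`M(ix);
         'X_iy * f^`M(iz) - 'X_iz * f^`M(iy)].

(* x^3, x^2y, xy^2, y^3, x^2z, xyz, y^2z, xz^2, yz^2, z^3 *)
Definition cubic_monomials : 10.-tuple 'X_{1..3} :=
  [tuple [multinom [tuple 3; 0; 0]]; [multinom [tuple 2; 1; 0]];
         [multinom [tuple 1; 2; 0]]; [multinom [tuple 0; 3; 0]];
         [multinom [tuple 2; 0; 1]]; [multinom [tuple 1; 1; 1]];
         [multinom [tuple 0; 2; 1]]; [multinom [tuple 1; 0; 2]];
         [multinom [tuple 0; 1; 2]]; [multinom [tuple 0; 0; 3]]]%N.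

Definition coef_vec (K : fieldType) (f : {mpoly K[3]}) : 'cV[K]_10 :=
  \col_(j < 10) f@_(tnth cubic_monomials j).

Definition gvec (K : fieldType) (f : {mpoly K[3]}) (P : 'rV[K]_3) : 'cV[K]_3 :=
  \col_(i < 3) evalp (tnth (gpolys f) i) P.

(* The j-th column is the vector (g_1(P), g_2(P), g_3(P)) of the j-th monomial;
   PhiP and Phi_unique show that this is the matrix determined by
   Phi P *m coef_vec f = gvec f P for all ternary cubic forms f. *)
Definition Phi (K : fieldType) (P : 'rV[K]_3) : 'M[K]_(3, 10) :=
  \matrix_(i < 3, j < 10)
    evalp (tnth (gpolys 'X_[tnth cubic_monomials j]) i) P.

Definition Phi_stack (K : fieldType) (n : nat) (P : n.-tuple 'rV[K]_3) :
    'M[K]_(\sum_(i < n) 3, 10) :=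
  \mxcol_(i < n) Phi (tnth P i).

Lemma gvec_linear (K : fieldType) (P : 'rV[K]_3) :
  linear (fun f => gvec f P).
Proof.
move=> a f g; apply/matrixP => i j; rewrite !mxE /evalp.
by case: i => -[|[|[|//]]] ?; rewrite !(tnth_nth 0) /= !mderivD !mderivZ
  !(mevalB, mevalD, mevalM, mevalZ); ring.
Qed.

Lemma mem_cubic_monomials (m : 'X_{1..3}) : mdeg m = 3%N -> m \in cubic_monomials.
Proof.
move=> dm.
have E : m = [multinom [tuple m ix; m iy; m iz]].
  apply/mnmP => -[[|[|[|//]]] lti]; rewrite multinomE (tnth_nth 0%N) /=;
    by congr (m _); apply: val_inj.
move: dm; rewrite mdegE !big_ord_recl big_ord0 addn0.
have -> : m ord0 = m ix by congr (m _); apply: val_inj.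
have -> : m (lift ord0 ord0) = m iy by congr (m _); apply: val_inj.
have -> : m (lift ord0 (lift ord0 ord0)) = m iz by congr (m _); apply: val_inj.
rewrite E; move: (m ix) (m iy) (m iz) => a b c.
rewrite !multinomE !(tnth_nth 0%N) /= => dm.
have : (a <= 3)%N by rewrite -dm leq_addr.
have : (b <= 3)%N by rewrite -dm addnCA leq_addr.
have : (c <= 3)%N by rewrite -dm addnA leq_addl.
case: a dm {E} => [|[|[|[|//]]]]; case: b => [|[|[|[|//]]]];
  by case: c => [|[|[|[|//]]]].
Qed.

Lemma uniq_cubic_monomials : uniq cubic_monomials.
Proof. by []. Qed.

Lemma cubic_expand (K : fieldType) (f : {mpoly K[3]}) :
  f \is 3.-homog ->
  f = \sum_(j < 10) f@_(tnth cubic_monomials j) *: 'X_[tnth cubic_monomials j].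
Proof.
move=> /dhomogP hf; apply/mpolyP => m; rewrite raddf_sum /=.
under eq_bigr do rewrite mcoeffZ mcoeffX.
have [/tnthP[j mj]|nm] := boolP (m \in cubic_monomials).
  rewrite (bigD1 j) //= -mj eqxx mulr1 big1 ?addr0 // => k kj.
  rewrite mj; case: eqP => [e|_]; last by rewrite mulr0.
  by case/eqP: kj; apply: (tuple_uniqP _ uniq_cubic_monomials).
rewrite big1 => [|j _].
  apply: memN_msupp_eq0; apply: contra nm => /hf; exact: mem_cubic_monomials.
case: eqP => [e|_]; last by rewrite mulr0.
by rewrite -e mem_tnth in nm.
Qed.

Lemma PhiP (K : fieldType) (P : 'rV[K]_3) (f : {mpoly K[3]}) :
  f \is 3.-homog -> Phi P *m coef_vec f = gvec f P.
Proof.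
move=> hf; pose g : {mpoly K[3]} -> 'cV[K]_3 := fun f => gvec f P.
have gl : linear g by exact: gvec_linear.
have gD : {morph g : x y / x + y}.
  by move=> x y; have := gl 1 x y; rewrite !scale1r.
have g0 : g 0 = 0 by apply: (addrI (g 0)); rewrite -gD !addr0.
have gZ a x : g (a *: x) = a *: g x by have := gl a x 0; rewrite g0 !addr0.
rewrite -[gvec f P]/(g f) {2}(cubic_expand hf) (big_morph g gD g0).
apply/matrixP => i k; rewrite mxE summxE; apply: eq_bigr => j _.
by rewrite gZ !mxE mulrC.
Qed.

Lemma Phi_unique (K : fieldType) (P : 'rV[K]_3) (A : 'M[K]_(3, 10)) :
  (forall f : {mpoly K[3]}, f \is 3.-homog -> A *m coef_vec f = gvec f P) ->
  A = Phi P.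
Proof.
move=> hA; apply/matrixP => i j.
have hX : ('X_[tnth cubic_monomials j] : {mpoly K[3]}) \is 3.-homog.
  rewrite dhomogX.
  by case: j => -[|[|[|[|[|[|[|[|[|[|//]]]]]]]]]] ?;
    rewrite (tnth_nth 0%MM) /= mdegE !big_ord_recl big_ord0
      !multinomE !(tnth_nth 0%N).
have cX : coef_vec ('X_[tnth cubic_monomials j] : {mpoly K[3]}) = delta_mx j 0.
  apply/matrixP => k l; rewrite !mxE mcoeffX [l]ord1 eqxx andbT.
  congr (_%:R); congr nat_of_bool; apply/eqP/eqP => [e|-> //].
  by apply/esym/(tuple_uniqP _ uniq_cubic_monomials).
by have := hA _ hX; rewrite cX -colE => /matrixP/(_ i 0); rewrite !mxE.
Qed.

(* Main.v *)
(* Identify a cubic f with its symmetric trilinear form F.  Then Phi(P) w_f = 0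
   says that P is an eigenpoint: F(P, P, .) = l <P, .> for some multiplier l.
   Rescale the representatives so that P3 ~ P1 + P2 and P5 ~ P1 + P4.  In the
   basis P1, P2, P4 every value of F except F(P1, P2, P4) is a multiplier at P1,
   P2 or P4 times an entry of the Gram matrix, and the equations at P3 and P5
   determine F(P1, P2, P4) and leave a 5 x 5 linear system in the five
   multipliers, of determinant -2 delta1 delta2 up to the rescaling.  Hence
   rk Phi(P1, ..., P5) = 5 + rk M with M the matrix of that system.

   Two of the equations involve only the multipliers of the line P1 P2 P3; they
   are independent unless the line is tangent to the conic at P1, P2 or P3, and
   otherwise their solutions are the multiples of a cross product whose first
   entry is delta1bar(P1, P2, P3).  The same holds for P1 P4 P5, and the rank of
   M follows by combining the possible kinds of the two lines. *)

Require Import Defs.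
From mathcomp Require Import all_boot all_order all_algebra ring zify.

Set Implicit Arguments.
Unset Strict Implicit.
Unset Printing Implicit Defensive.

Import GRing.Theory Num.Theory.

Local Open Scope ring_scope.

(** * Linear algebra *)

Section LinearCombinations.

Variable K : idomainType.
Implicit Types a b c s t k x : K.

(** Linear-combination certificates: hypotheses weighted and added by [eqM] and [eqD] form [s = t],
    and only the polynomial identity [a - b = s - t] remains for [ring]. *)
Lemma eq_by_diff s t a b : s = t -> a - b = s - t -> a = b.
Proof. by move=> -> e; apply/eqP; rewrite -subr_eq0 e subrr. Qed.

Lemma eqM c s t : s = t -> c * s = c * t.
Proof. by move->. Qed.

Lemma eqD a b s t : a = b -> s = t -> a + s = b + t.
Proof. by move=> -> ->. Qed.

Lemma mulIf_eq0 k x : k != 0 -> k * x = 0 -> x = 0.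
Proof. by move=> k0 /eqP; rewrite mulf_eq0 (negPf k0) => /eqP. Qed.

End LinearCombinations.

Section Determinants.

Variable K : comPzRingType.

(** Expansion along the first row as a computable function of the entries, so that a concrete
    determinant simplifies to an explicit polynomial for [ring]. *)
Fixpoint laplace n (f : nat -> nat -> K) : K :=
  if n is m.+1 then
    foldr (fun j s =>
      f 0%N j * ((-1) ^+ j * laplace m (fun i k => f i.+1 (bump j k))) + s)
      0 (iota 0 n)
  else 1.

Lemma det_laplace n (f : nat -> nat -> K) :
  \det (\matrix_(i < n, j < n) f i j) = laplace n f.
Proof.
elim: n f => [|n IHn] f; first by rewrite det_mx00.
have -> : laplace n.+1 f = \sum_(j < n.+1)
    f 0%N j * ((-1) ^+ j * laplace n (fun i k => f i.+1 (bump j k))).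
  rewrite -(big_mkord xpredT (fun j => f 0%N j *
    ((-1) ^+ j * laplace n (fun i k => f i.+1 (bump j k))))).
  by rewrite unlock.
rewrite (expand_det_row _ ord0); apply: eq_bigr => j _.
rewrite mxE /cofactor add0n -IHn; congr (_ * (_ * \det _)).
by apply/matrixP => i k; rewrite !mxE.
Qed.

End Determinants.

Section RankBounds.

Variable K : fieldType.

(** The hypothesis makes projection to the coordinates in [s] injective on the left kernel of [A],
    whose dimension [m - \rank A] is thus at most [size s]. *)
Lemma rank_ge_pinned m n (A : 'M[K]_(m, n)) (s : seq 'I_m) :
  (forall x : 'rV_m, x *m A = 0 -> {in s, forall i, x 0 i = 0} -> x = 0) ->
  (m <= \rank A + size s)%N.
Proof.
move=> hA; pose B := colsub (tnth (in_tuple s)) (1%:M : 'M[K]_m).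
have BE (x : 'rV_m) i : (x *m B) 0 i = x 0 (tnth (in_tuple s) i).
  by rewrite mulmx_colsub mulmx1 mxE.
have AB0 : (kermx A :&: kermx B = 0)%MS.
  apply/eqP/rowV0P => x; rewrite sub_capmx => /andP[/sub_kermxP xA /sub_kermxP xB].
  apply: hA => // i /(nthP i)[k ks <-].
  by have := BE x (Ordinal ks); rewrite xB mxE (tnth_nth i) => /esym.
have := mxrank_mul_ker (kermx A) B; rewrite AB0 mxrank0 addn0 mxrank_ker => e.
by rewrite -leq_subLR -e rank_leq_col.
Qed.

Lemma rank2_col_mx n (x y : 'rV[K]_n) i j :
  x 0 i != 0 -> y 0 i = 0 -> y 0 j != 0 -> \rank (col_mx x y) = 2%N.
Proof.
move=> xi yi yj; apply/eqP/(inj_row_free (A := col_mx x y)) => v.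
rewrite -[v]hsubmxK mul_row_col [lsubmx v]mx11_scalar [rsubmx v]mx11_scalar.
rewrite !mul_scalar_mx; move: (lsubmx v 0 0) (rsubmx v 0 0) => a b /rowP e.
have /eqP := e i; rewrite !mxE yi mulr0 addr0 mulf_eq0 (negPf xi) orbF => /eqP a0.
have /eqP := e j; rewrite !mxE a0 mul0r add0r mulf_eq0 (negPf yj) orbF => /eqP b0.
by rewrite b0 !raddf0 row_mx0.
Qed.

Lemma rank_le_two_kernel m n (A : 'M[K]_(m, n)) (x y : 'rV_m) i j :
  x *m A = 0 -> y *m A = 0 -> x 0 i != 0 -> y 0 i = 0 -> y 0 j != 0 ->
  (\rank A + 2 <= m)%N.
Proof.
move=> xA yA xi yi yj; rewrite addnC -(rank2_col_mx xi yi yj).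
by apply: mulmx0_rank_max; rewrite mul_col_mx xA yA col_mx0.
Qed.

End RankBounds.

(** * The linear system in the multipliers *)

Section ReducedSystem.

Variable K : numFieldType.
Implicit Types p q r t u v : K.

(* p, q, r, t, u, v stand for s11, s12, s22, s14, s44, s24 after rescaling to
   P3 = P1 + P2 and P5 = P1 + P4.  Rows are indexed by the multipliers at
   P1, ..., P5; columns are the equations at P3 paired with P1 and P2, at P5
   paired with P1 and P4, and the difference of those at P5 paired with P2 and at
   P3 paired with P4, which eliminates F(P1, P2, P4). *)
Definition reduced_entries p q r t u v : seq (seq K) :=
  [:: [:: p + 2 * q; q; p + 2 * t; t; t - q];
      [:: q; 2 * q + r; 0; 0; v];
      [:: - (p + q); - (q + r); 0; 0; - (t + v)];
      [:: 0; 0; t; 2 * t + u; - v];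
      [:: 0; 0; - (p + t); - (t + u); q + v]].

Definition reduced_mx p q r t u v : 'M[K]_5 :=
  \matrix_(i, j) nth 0 (nth [::] (reduced_entries p q r t u v) i) j.

Definition line_system p q r x1 x2 x3 : Prop :=
  (p + 2 * q) * x1 + q * x2 - (p + q) * x3 = 0 /\
  q * x1 + (2 * q + r) * x2 - (q + r) * x3 = 0.

Definition solution p q r t u v (l : nat -> K) : Prop :=
  [/\ line_system p q r (l 0%N) (l 1%N) (l 2%N), line_system p t u (l 0%N) (l 3%N) (l 4%N)
    & (t - q) * l 0%N + v * l 1%N - (t + v) * l 2%N - v * l 3%N + (q + v) * l 4%N = 0].

Lemma sum_ord5 (F : nat -> K) :
  \sum_(i < 5) F i = F 0%N + F 1%N + F 2%N + F 3%N + F 4%N.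
Proof. by rewrite !big_ord_recl big_ord0 addr0 !addrA. Qed.

Lemma reduced_mxP p q r t u v (x : 'rV_5) :
  x *m reduced_mx p q r t u v = 0 <->
  solution p q r t u v (fun k => x 0 (inord k)).
Proof.
have E (j : 'I_5) : (x *m reduced_mx p q r t u v) 0 j =
    \sum_(i < 5) x 0 (inord i) * nth 0 (nth [::] (reduced_entries p q r t u v) i) j.
  by rewrite mxE; apply: eq_bigr => i _; rewrite mxE inord_val.
have {}E j (j5 : (j < 5)%N) := etrans (E (Ordinal j5)) (sum_ord5
  (fun i => x 0 (inord i) * nth 0 (nth [::] (reduced_entries p q r t u v) i) j)).
split=> [e0|[[e1 e2] [e3 e4] e5]].
  have e j (j5 : (j < 5)%N) := etrans (esym (E j j5))
    (congr1 (fun A : 'rV_5 => A 0 (Ordinal j5)) e0).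
  split; [split|split|].
  - by have := e 0%N isT; rewrite mxE /= => <-; ring.
  - by have := e 1%N isT; rewrite mxE /= => <-; ring.
  - by have := e 2%N isT; rewrite mxE /= => <-; ring.
  - by have := e 3%N isT; rewrite mxE /= => <-; ring.
  - by have := e 4%N isT; rewrite mxE /= => <-; ring.
apply/rowP=> -[[|[|[|[|[|//]]]]] j5]; rewrite E mxE /=;
  [apply: etrans e1|apply: etrans e2|apply: etrans e3|apply: etrans e4|apply: etrans e5]; ring.
Qed.

Lemma det_reduced_mx p q r t u v :
  \det (reduced_mx p q r t u v) =
  - 2 * (p * v - q * t) * (q * (p + q) * (t + u) - t * (p + t) * (q + r)).
Proof.
rewrite /reduced_mx.
rewrite (det_laplace 5 (fun i j => nth 0 (nth [::] (reduced_entries p q r t u v) i) j)).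
rewrite /=; ring.
Qed.

(** * Solutions on a single line and its tangency to the conic *)

Definition cross1 p q r : K := p * (q + r) + q * (p + q).
Definition cross2 p q r : K := p * r + 2 * q * r + q ^+ 2.
Definition cross3 p q r : K := p * r + 2 * p * q + 2 * q * r + 3 * q ^+ 2.

(** Cross product of the two coefficient rows of [line_system]; [cross1] is arranged to show
    [delta1bar] at P1, P2, P1 + P2. *)
Definition cross p q r : seq K := [:: cross1 p q r; cross2 p q r; cross3 p q r].

(** The three cases are tangency of the line at P1, P2 and P3. They come from
    [cross3 - cross2 = 2 * q * (p + q)] and [cross3 - cross1 = 2 * q * (q + r)]. *)
Lemma cross_eq0 p q r :
  cross1 p q r = 0 -> cross2 p q r = 0 -> cross3 p q r = 0 ->
  [\/ p = 0 /\ q = 0, q = 0 /\ r = 0 | p = - q /\ r = - q].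
Proof.
rewrite /cross1 /cross2 /cross3 => c1 c2 c3.
have n2 : (2 : K) != 0 by rewrite pnatr_eq0.
have [q0|q0] := eqVneq q 0.
  have /eqP : p * r = 0 by rewrite -c1 q0; ring.
  by rewrite mulf_eq0 => /orP[]/eqP ->; [apply: Or31|apply: Or32].
apply: Or33; split.
  apply: (mulfI (mulf_neq0 n2 q0)).
  by apply: (eq_by_diff (eqD c3 (eqM (-1) c2))); ring.
apply: (mulfI (mulf_neq0 n2 q0)).
by apply: (eq_by_diff (eqD c3 (eqM (-1) c1))); ring.
Qed.

(** A solution is orthogonal to both coefficient rows, hence proportional to their cross product;
    stated by minors to cover a zero cross product. *)
Lemma line_system_cross p q r x1 x2 x3 : line_system p q r x1 x2 x3 ->
  [/\ x1 * cross2 p q r = x2 * cross1 p q r,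
      x1 * cross3 p q r = x3 * cross1 p q r
    & x2 * cross3 p q r = x3 * cross2 p q r].
Proof.
rewrite /cross1 /cross2 /cross3 => -[e1 e2]; split.
- by apply: (eq_by_diff (eqD (eqM (- (p + q)) e2) (eqM (q + r) e1))); ring.
- by apply: (eq_by_diff (eqD (eqM (- q) e2) (eqM (2 * q + r) e1))); ring.
- by apply: (eq_by_diff (eqD (eqM (p + 2 * q) e2) (eqM (- q) e1))); ring.
Qed.

Lemma line_system_eq0 p q r (x : nat -> K) k : (k < 3)%N ->
  nth 0 (cross p q r) k != 0 -> line_system p q r (x 0%N) (x 1%N) (x 2%N) ->
  x k = 0 -> [/\ x 0%N = 0, x 1%N = 0 & x 2%N = 0].
Proof.
move=> k3 ck /line_system_cross[c12 c13 c23] xk.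
case: k k3 ck xk => [|[|[|//]]] _ /= ck xk; rewrite ?xk; split=> //;
  apply: (mulIf_eq0 ck); rewrite mulrC.
- by rewrite -c12 xk mul0r.
- by rewrite -c13 xk mul0r.
- by rewrite c12 xk mul0r.
- by rewrite -c23 xk mul0r.
- by rewrite c13 xk mul0r.
- by rewrite c23 xk mul0r.
Qed.

(** The multipliers listed in [s] determine a solution, which bounds the rank of the reduced matrix
    below by [5 - size s]. *)
Definition pinned p q r t u v (s : seq nat) : Prop :=
  forall l, solution p q r t u v l -> {in s, forall k, l k = 0} ->
  forall k, (k < 5)%N -> l k = 0.

Definition swap_lines (k : nat) : nat := nth 0%N [:: 0; 3; 4; 1; 2]%N k.

(** Exchanging the two lines only changes the sign of the fifth equation. *)
Lemma pinned_swap p q r t u v s :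
  pinned p t u q r v s -> pinned p q r t u v (map swap_lines s).
Proof.
move=> h l [e12 e14 e5] ls.
have h0 k : (k < 5)%N -> l (swap_lines k) = 0.
  apply: (h (l \o swap_lines)) => [|j js]; last by apply: ls; apply: map_f.
  by split=> //=; apply: (eq_by_diff (eqM (-1) e5)); ring.
move=> [|[|[|[|[|//]]]]] _;
  [exact: (h0 0%N)|exact: (h0 3%N)|exact: (h0 4%N)|exact: (h0 1%N)|exact: (h0 2%N)].
Qed.

(** Determinant of the Gram matrix with rows [(p, q, t)], [(q, r, v)], [(t, v, u)]. *)
Definition gram p q r t u v : K :=
  p * (r * u - v ^+ 2) - q * (q * u - v * t) + t * (q * v - r * t).

Lemma gram_swap p q r t u v : gram p q r t u v = gram p t u q r v.
Proof. by rewrite /gram; ring. Qed.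

(* The line P1 P2 is tangent to the isotropic conic at P2 or at P3 = P1 + P2. *)
Definition tangent23 p q r : Prop :=
  q = 0 /\ r = 0 \/ p + q = 0 /\ q + r = 0.

Lemma line_kind p q r :
  [\/ exists2 k, (k < 3)%N & nth 0 (cross p q r) k != 0,
      p = 0 /\ q = 0 | tangent23 p q r].
Proof.
have [c1|c1] := eqVneq (cross1 p q r) 0; last by apply: Or31; exists 0%N.
have [c2|c2] := eqVneq (cross2 p q r) 0; last by apply: Or31; exists 1%N.
have [c3|c3] := eqVneq (cross3 p q r) 0; last by apply: Or31; exists 2%N.
case: (cross_eq0 c1 c2 c3) => -[h1 h2]; [exact: Or32|apply: Or33; left|apply: Or33; right] => //.
by rewrite h1 h2 addNr subrr.
Qed.

(** Here the first line is tangent at P1. The Gram determinant reduces to [- r * t ^+ 2], so [r] and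
    [t] can be cancelled from the equations. *)
Lemma pinned_tangent1 p q r t u v : gram p q r t u v != 0 ->
  p = 0 /\ q = 0 -> pinned p q r t u v [:: 0%N].
Proof.
rewrite /gram => g0 [p0 q0]; rewrite p0 q0 in g0 * => l [[_ e2] [e3 e4] e5] l0.
have {}l0 : l 0%N = 0 by apply: l0; rewrite inE.
have t0 : t != 0 by apply: contra_neq g0 => ->; ring.
have r0 : r != 0 by apply: contra_neq g0 => ->; ring.
rewrite l0 in e2 e3 e4 e5.
have l34 : l 3%N = l 4%N.
  by apply: (mulfI t0); apply: (eq_by_diff e3); ring.
have l3 : l 3%N = 0.
  by apply: (mulIf_eq0 t0); rewrite -e4 -l34; ring.
have l12 : l 1%N = l 2%N.
  by apply: (mulfI r0); apply: (eq_by_diff e2); ring.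
have l1 : l 1%N = 0.
  by apply: (mulIf_eq0 t0); apply: (eq_by_diff (eqM (-1) e5)); rewrite -l34 -l12 l3; ring.
by case=> [|[|[|[|[|//]]]]] _; rewrite -?l12 -?l34.
Qed.

(** The Gram determinant becomes a multiple of [p * v - q * t], with cofactor [- v] for tangency at
    P2 and [- (t + v)] for tangency at P3. *)
Lemma delta1_tangent23 p q r t u v : gram p q r t u v != 0 ->
  tangent23 p q r -> p * v - q * t != 0.
Proof.
rewrite /gram => g0 [[q0 r0]|[pq qr]]; apply: contra_neq g0.
  rewrite q0 r0 => e; apply: (eq_by_diff (eqM (- v) e)); ring.
have -> : p = - q by apply/eqP; rewrite -addr_eq0 pq.
have -> : r = - q by apply/eqP; rewrite -addr_eq0 addrC qr.
by move=> e; apply: (eq_by_diff (eqM (- (t + v)) e)); ring.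
Qed.

(** The two equations of the tangent line are dependent, but the first and the fifth, as equations
    in [l 1] and [l 2], have determinant [p * v - q * t], nonzero by [delta1_tangent23]. *)
Lemma tangent23_pins p q r t u v l : gram p q r t u v != 0 ->
  tangent23 p q r -> solution p q r t u v l ->
  l 0%N = 0 -> l 3%N = 0 -> l 4%N = 0 -> forall k, (k < 5)%N -> l k = 0.
Proof.
move=> g0 T [[e1 e2] _ e5] l0 l3 l4; rewrite l0 l3 l4 in e1 e2 e5.
have d0 := delta1_tangent23 g0 T.
suff [l1 l2] : l 1%N = 0 /\ l 2%N = 0 by case=> [|[|[|[|[|]]]]].
case: T => -[h1 h2].
  have l2 : l 2%N = 0.
    apply: (mulIf_eq0 d0); apply: (eq_by_diff (eqM (-v) e1)).
    by rewrite h1; ring.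
  split=> //; apply: (mulIf_eq0 d0); apply: (eq_by_diff (eqM p e5)).
  by rewrite h1 l2; ring.
have p0 : p = - q by apply/eqP; rewrite -addr_eq0 h1.
have q0 : q != 0 by apply: contra_neq d0 => q0; rewrite p0 q0; ring.
have l1 : l 1%N = 0.
  by apply: (mulIf_eq0 q0); apply: (eq_by_diff e1); rewrite p0; ring.
split=> //; apply: (mulIf_eq0 d0); apply: (eq_by_diff (eqM q e5)).
by rewrite p0 l1; ring.
Qed.

Definition line2_index (k : nat) : nat := nth 0%N [:: 0; 3; 4]%N k.

Lemma pinned_tangent23_cross p q r t u v k : gram p q r t u v != 0 ->
  tangent23 p q r -> (k < 3)%N -> nth 0 (cross p t u) k != 0 ->
  pinned p q r t u v [:: line2_index k].
Proof.
move=> g0 T k3 ck l s lk.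
have [_ e34 _] := s.
have [] := @line_system_eq0 p t u (l \o line2_index) k k3 ck e34.
  by apply: lk; rewrite inE.
by move=> /= l0 l3 l4; apply: (tangent23_pins g0 T s l0 l3 l4).
Qed.

Lemma pinned_cross2 p q r t u v k j : (k < 3)%N -> nth 0 (cross p q r) k != 0 ->
  (j < 3)%N -> nth 0 (cross p t u) j != 0 ->
  pinned p q r t u v [:: k; line2_index j].
Proof.
move=> k3 ck j3 cj l [e12 e34 _] lk.
have [|l0 l1 l2] := @line_system_eq0 p q r l k k3 ck e12.
  by apply: lk; rewrite inE eqxx.
have [|_ l3 l4] := @line_system_eq0 p t u (l \o line2_index) j j3 cj e34.
  by apply: lk; rewrite !inE eqxx orbT.
by case=> [|[|[|[|[|]]]]].
Qed.

(** Under the pins the first equation of the second line reads [- p * l 4 = 0] for tangency at P4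
    and [t * l 3 = 0] for tangency at P5; then [tangent23_pins] settles the first line. *)
Lemma pinned_tangent23_both p q r t u v : gram p q r t u v != 0 ->
  tangent23 p q r -> tangent23 p t u ->
  pinned p q r t u v [:: 0; 3]%N \/ pinned p q r t u v [:: 0; 4]%N.
Proof.
move=> g0 T12 T14.
have d0 : p * v - t * q != 0.
  by apply: delta1_tangent23 T14; rewrite -gram_swap; exact: g0.
have [[h1 h2]|[h1 h2]] := T14; [left|right].
  move=> l s ls; have [_ [e3 _] _] := s.
  have l0 : l 0%N = 0 by apply: ls; rewrite inE eqxx.
  have l3 : l 3%N = 0 by apply: ls; rewrite !inE eqxx orbT.
  apply: (tangent23_pins g0 T12 s l0 l3 _).
  have p0 : p != 0 by apply: contra_neq d0 => p0; rewrite p0 h1; ring.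
  by apply: (mulIf_eq0 p0); apply: (eq_by_diff (eqM (-1) e3)); rewrite l0 l3 h1; ring.
move=> l s ls; have [_ [e3 _] _] := s.
have l0 : l 0%N = 0 by apply: ls; rewrite inE eqxx.
have l4 : l 4%N = 0 by apply: ls; rewrite !inE eqxx orbT.
apply: (tangent23_pins g0 T12 s l0 _ l4).
have pt : p = - t by apply/eqP; rewrite -addr_eq0 h1.
have t0 : t != 0 by apply: contra_neq d0 => t0; rewrite pt t0; ring.
by apply: (mulIf_eq0 t0); apply: (eq_by_diff e3); rewrite l0 l4; ring.
Qed.

(** If [cross1] and [cross3] vanish, then [q * (q + r) = 0], and [cross2] vanishes too. So when
    [cross1 = 0] the last multiplier of the line determines its solution. *)
Lemma cross1_eq0_cross3 p q r k : cross1 p q r = 0 -> (k < 3)%N ->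
  nth 0 (cross p q r) k != 0 -> cross3 p q r != 0.
Proof.
move=> c1 k3; apply: contra_neq => c3.
have n2 : (2 : K) != 0 by rewrite pnatr_eq0.
move: c1 c3; rewrite /cross /cross1 /cross2 /cross3 => c1 c3.
have /eqP : q * (q + r) = 0.
  by apply: (mulIf_eq0 n2); apply: (eq_by_diff (eqD c3 (eqM (-1) c1))); ring.
rewrite mulf_eq0 => e.
have c2 : p * r + 2 * q * r + q ^+ 2 = 0.
  case/orP: e => /eqP e; first by rewrite -c1 e; ring.
  have /eqP : q * (p + q) = 0 by rewrite -c1 e; ring.
  rewrite mulf_eq0 => /orP[]/eqP e'; first by rewrite -c1 e'; ring.
  by apply: (eq_by_diff (eqD (eqM r e') (eqM q e))); ring.
by case: k k3 => [|[|[|//]]] _.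
Qed.

Definition cond_a p q r t u v : Prop :=
  [/\ p * v - q * t = 0, cross1 p q r = 0 & cross1 p t u = 0].

Definition cond_b p q r t u : Prop := tangent23 p q r /\ tangent23 p t u.

(** A line with [cross1 != 0] is determined by the shared multiplier [l 0]; one with [cross1 = 0] by
    its last multiplier, whose vanishing forces [l 0 = 0]. If [cross1] vanishes on both lines, the
    fifth equation links them, because [p * v - q * t != 0]. *)
Lemma pinned_cross1 p q r t u v k j : ~ cond_a p q r t u v ->
  (k < 3)%N -> nth 0 (cross p q r) k != 0 ->
  (j < 3)%N -> nth 0 (cross p t u) j != 0 ->
  pinned p q r t u v [:: 0]%N \/ pinned p q r t u v [:: 2]%N \/
  pinned p q r t u v [:: 4]%N.
Proof.
move=> na k3 ck j3 cj; have n2 : (2 : K) != 0 by rewrite pnatr_eq0.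
have [c0|c0] := eqVneq (cross1 p q r) 0; have [d0|d0] := eqVneq (cross1 p t u) 0.
- right; right => l s ls; have [e12 e34 e5] := s.
  have l4 : l 4%N = 0 by apply: ls; rewrite inE.
  have c3 := cross1_eq0_cross3 c0 k3 ck; have d3 := cross1_eq0_cross3 d0 j3 cj.
  have [/= l0 l3 _] :=
    @line_system_eq0 p t u (l \o line2_index) 2 isT d3 e34 l4.
  have [_ _ c12] := line_system_cross e12.
  suff l2 : l 2%N = 0.
    have [_ l1 _] := @line_system_eq0 p q r l 2 isT c3 e12 l2.
    by case=> [|[|[|[|[|]]]]].
  have qr0 : q * (q + r) != 0.
    apply: contra_neq c3 => e; rewrite /cross1 in c0.
    by apply: (eq_by_diff (eqD c0 (eqM 2 e))); rewrite /cross3; ring.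
  have d1 : p * v - q * t != 0 by apply/eqP => d1; apply: na.
  (* Inserting the proportionality of [l 1] and [l 2] into the fifth equation leaves this factor
     times [l 2]. Modulo [cross1], [q] times it is [2 * q * (q + r) * (p * v - q * t)]. *)
  have nz : v * cross2 p q r - (t + v) * cross3 p q r != 0.
    apply: contra_neq d1 => e; apply: (mulIf_eq0 (mulf_neq0 n2 qr0)).
    apply: (eq_by_diff (eqD (eqM (2 * q * v + q * t) c0) (eqM q e))).
    by rewrite /cross1 /cross2 /cross3; ring.
  apply: (mulIf_eq0 nz).
  apply: (eq_by_diff (eqD (eqM (- v) c12) (eqM (cross3 p q r) e5))).
  by rewrite l0 l3 l4 /=; ring.
- right; left => l s ls; have [e12 e34 _] := s.
  have l2 : l 2%N = 0 by apply: ls; rewrite inE.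
  have c3 := cross1_eq0_cross3 c0 k3 ck.
  have [l0 l1 _] := @line_system_eq0 p q r l 2 isT c3 e12 l2.
  have [_ l3 l4] := @line_system_eq0 p t u (l \o line2_index) 0 isT d0 e34 l0.
  by case=> [|[|[|[|[|]]]]].
- right; right => l s ls; have [e12 e34 _] := s.
  have l4 : l 4%N = 0 by apply: ls; rewrite inE.
  have d3 := cross1_eq0_cross3 d0 j3 cj.
  have [/= l0 l3 _] :=
    @line_system_eq0 p t u (l \o line2_index) 2 isT d3 e34 l4.
  have [_ l1 l2] := @line_system_eq0 p q r l 0 isT c0 e12 l0.
  by case=> [|[|[|[|[|]]]]].
left => l s ls; have [e12 e34 _] := s.
have l0 : l 0%N = 0 by apply: ls; rewrite inE.
have [_ l1 l2] := @line_system_eq0 p q r l 0 isT c0 e12 l0.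
have [_ l3 l4] := @line_system_eq0 p t u (l \o line2_index) 0 isT d0 e34 l0.
by case=> [|[|[|[|[|]]]]].
Qed.

Lemma pinned_swap1 p q r t u v k :
  (k < 5)%N -> pinned p t u q r v [:: k] -> exists2 j, (j < 5)%N & pinned p q r t u v [:: j].
Proof.
move=> k5 /pinned_swap h; exists (swap_lines k) => //.
by move: k k5 {h} => [|[|[|[|[|//]]]]].
Qed.

(** Of the nine combinations of line kinds, all but two are settled by a single pin: those with a
    line tangent at P1, and those with exactly one line tangent at another of its points. *)
Lemma line_kinds p q r t u v : gram p q r t u v != 0 ->
  [\/ exists2 k, (k < 3)%N & nth 0 (cross p q r) k != 0 /\
        exists2 j, (j < 3)%N & nth 0 (cross p t u) j != 0,
      cond_b p q r t u
    | exists2 k, (k < 5)%N & pinned p q r t u v [:: k]].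
Proof.
move=> g0; have g0' := g0; rewrite gram_swap in g0'.
have [[k k3 ck]|T12|T12] := line_kind p q r.
- have [[j j3 cj]|T14|T14] := line_kind p t u.
  + by apply: Or31; exists k => //; split=> //; exists j.
  + apply: Or33; apply: (@pinned_swap1 _ _ _ _ _ _ 0) => //.
    exact: pinned_tangent1.
  apply: Or33; apply: (@pinned_swap1 _ _ _ _ _ _ (line2_index k)).
    by case: k k3 {ck} => [|[|[|]]].
  exact: pinned_tangent23_cross.
- by apply: Or33; exists 0%N => //; apply: pinned_tangent1.
have [[j j3 cj]|T14|T14] := line_kind p t u; last exact: Or32.
  apply: Or33; exists (line2_index j); first by case: j j3 {cj} => [|[|[|]]].
  exact: pinned_tangent23_cross.
apply: Or33; apply: (@pinned_swap1 _ _ _ _ _ _ 0) => //.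
exact: pinned_tangent1.
Qed.

(** * Rank of the reduced matrix *)

Lemma rank_reduced_ge p q r t u v (s : seq nat) :
  all (gtn 5) s -> pinned p q r t u v s ->
  (5 <= \rank (reduced_mx p q r t u v) + size s)%N.
Proof.
move=> s5 h; rewrite -(size_map (@inord 4)).
apply: rank_ge_pinned => x /reduced_mxP sx xs.
apply/rowP => i; rewrite mxE -(inord_val i).
apply: (h _ sx _ i (ltn_ord i)) => k ks; apply: xs.
exact: map_f.
Qed.

Lemma rank_reduced_ge3 p q r t u v : gram p q r t u v != 0 ->
  (3 <= \rank (reduced_mx p q r t u v))%N.
Proof.
move=> g0; rewrite -(leq_add2r 2).
have [[k k3 [ck [j j3 cj]]]|[T12 T14]|[k k5 h]] := line_kinds g0.
- have j5 : (line2_index j < 5)%N by case: j j3 {cj} => [|[|[|]]].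
  apply: (@rank_reduced_ge _ _ _ _ _ _ [:: k; line2_index j]).
    by rewrite /= j5 (ltn_trans k3).
  exact: pinned_cross2.
- have [h|h] := pinned_tangent23_both g0 T12 T14.
    exact: (@rank_reduced_ge _ _ _ _ _ _ [:: 0; 3]%N).
  exact: (@rank_reduced_ge _ _ _ _ _ _ [:: 0; 4]%N).
apply: leq_trans (@rank_reduced_ge _ _ _ _ _ _ [:: k] _ h) _.
  by rewrite /= k5.
by rewrite leq_add2l.
Qed.

Lemma rank_reduced_ge4 p q r t u v : gram p q r t u v != 0 ->
  ~ cond_a p q r t u v -> ~ cond_b p q r t u ->
  (4 <= \rank (reduced_mx p q r t u v))%N.
Proof.
move=> g0 na nb; rewrite -(leq_add2r 1).
have [[k k3 [ck [j j3 cj]]]|//|[k k5 h]] := line_kinds g0.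
  by have [h|[h|h]] := pinned_cross1 na k3 ck j3 cj; apply: (rank_reduced_ge _ h).
by apply: (rank_reduced_ge _ h); rewrite /= k5.
Qed.

(** For tangency at P2 the second equation of the line vanishes identically; for tangency at P3 the
    two equations coincide. *)
Lemma tangent23_dependent p q r : tangent23 p q r ->
  exists a b, [/\ b != 0, a * (p + 2 * q) + b * q = 0,
    a * q + b * (2 * q + r) = 0 & a * (p + q) + b * (q + r) = 0].
Proof.
case=> -[h1 h2]; [exists 0, 1|exists 1, (-1)];
  rewrite ?oppr_eq0 oner_neq0; split=> //.
- by rewrite h1; ring.
- by rewrite h1 h2; ring.
- by rewrite h1 h2; ring.
- by apply: (eq_by_diff h1); ring.
- by apply: (eq_by_diff (eqM (-1) h2)); ring.
- by rewrite h1 h2; ring.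
Qed.

Lemma rank_reduced_le3_b p q r t u v : cond_b p q r t u ->
  (\rank (reduced_mx p q r t u v) <= 3)%N.
Proof.
move=> [/tangent23_dependent[a [b [b0 x1 x2 x3]]] /tangent23_dependent[c [d [d0 y1 y2 y3]]]].
(* Each row is a relation between the two columns belonging to one line, hence a kernel vector of
   the transpose. *)
pose z := [:: [:: a; b; 0; 0; 0]; [:: 0; 0; c; d; 0]].
pose x k : 'rV[K]_5 := \row_j nth 0 (nth [::] z k) j.
have zk (k : nat) : (forall i, (i < 5)%N -> \sum_(j < 5) nth 0 (nth [::] z k) j *
    nth 0 (nth [::] (reduced_entries p q r t u v) i) j = 0) ->
    x k *m (reduced_mx p q r t u v)^T = 0.
  by move=> h; apply/rowP => i; rewrite !mxE -[RHS](h i) //; apply: eq_bigr => j _; rewrite !mxE.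
have [z0 z1] : x 0%N *m (reduced_mx p q r t u v)^T = 0 /\
    x 1%N *m (reduced_mx p q r t u v)^T = 0.
  split; apply: zk => i i5.
    rewrite (sum_ord5 (fun j => nth 0 (nth [::] z 0%N) j *
      nth 0 (nth [::] (reduced_entries p q r t u v) i) j)).
    case: i i5 => [|[|[|[|[|//]]]]] _ /=.
    - by apply: (eq_by_diff x1); ring.
    - by apply: (eq_by_diff x2); ring.
    - by apply: (eq_by_diff (eqM (-1) x3)); ring.
    - by ring.
    - by ring.
  rewrite (sum_ord5 (fun j => nth 0 (nth [::] z 1%N) j *
    nth 0 (nth [::] (reduced_entries p q r t u v) i) j)).
  case: i i5 => [|[|[|[|[|//]]]]] _ /=.
  - by apply: (eq_by_diff y1); ring.
  - by ring.
  - by ring.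
  - by apply: (eq_by_diff y2); ring.
  - by apply: (eq_by_diff (eqM (-1) y3)); ring.
rewrite -(leq_add2r 2) -mxrank_tr.
apply: (@rank_le_two_kernel _ _ _ _ (x 0%N) (x 1%N)
  (Ordinal (isT : 1 < 5)%N) (Ordinal (isT : 3 < 5)%N)) => //; by rewrite mxE.
Qed.

(** Tangency at P1 would give [t * t = 0] from the second line and a zero Gram determinant; tangency
    at P2 or P3 contradicts [p * v - q * t = 0]. *)
Lemma cond_a_cross3 p q r t u v : gram p q r t u v != 0 ->
  cond_a p q r t u v -> cross3 p q r != 0.
Proof.
move=> g0 [d1 c1 c1'].
have [[k k3 ck]|[p0 q0]|T] := line_kind p q r.
- exact: cross1_eq0_cross3 c1 k3 ck.
- case/eqP: g0; have /eqP : t * t = 0 by rewrite -c1' /cross1 p0; ring.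
  by rewrite mulf_eq0 orbb => /eqP t0; rewrite /gram p0 q0 t0; ring.
by case/eqP: (delta1_tangent23 g0 T).
Qed.

Lemma reduced_mx_ker p q r t u v (s : seq K) :
  solution p q r t u v (nth 0 s) ->
  (\row_(k < 5) nth 0 s k) *m reduced_mx p q r t u v = 0.
Proof.
by move=> sol; apply/reduced_mxP; rewrite /solution !mxE !inordK.
Qed.

(* When [cross1] vanishes on both lines the cross products have first entry 0,
   so each line contributes a solution supported on its own multipliers. *)
Lemma rank_reduced_le3_a p q r t u v : gram p q r t u v != 0 ->
  cond_a p q r t u v -> (\rank (reduced_mx p q r t u v) <= 3)%N.
Proof.
move=> g0 a; have [d1 c1 c1'] := a.
have c3 := cond_a_cross3 g0 a.
have d3 : cross3 p t u != 0.
  rewrite gram_swap in g0; apply: (cond_a_cross3 g0); split=> //.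
  by rewrite -d1; ring.
rewrite -(leq_add2r 2).
apply: (@rank_le_two_kernel _ _ _ _
  (\row_k nth 0 [:: 0; cross2 p q r; cross3 p q r; 0; 0] k)
  (\row_k nth 0 [:: 0; 0; 0; cross2 p t u; cross3 p t u] k)
  (Ordinal (isT : 2 < 5)%N) (Ordinal (isT : 4 < 5)%N)); rewrite ?mxE //;
  apply: reduced_mx_ker; split; [split|split| |split|split|] => /=; try by ring.
- by apply: (eq_by_diff (eqM (- (p + 2 * q)) c1)); rewrite /cross1 /cross2 /cross3; ring.
- by apply: (eq_by_diff (eqM (- q) c1)); rewrite /cross1 /cross2 /cross3; ring.
- apply: (eq_by_diff (eqD (eqM (2 * (q + r)) d1) (eqM (- (2 * v + t)) c1))).
  by rewrite /cross1 /cross2 /cross3; ring.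
- by apply: (eq_by_diff (eqM (- (p + 2 * t)) c1')); rewrite /cross1 /cross2 /cross3; ring.
- by apply: (eq_by_diff (eqM (- t) c1')); rewrite /cross1 /cross2 /cross3; ring.
- apply: (eq_by_diff (eqD (eqM (- 2 * (t + u)) d1) (eqM (2 * v + q) c1'))).
  by rewrite /cross1 /cross2 /cross3; ring.
Qed.

(** The boolean form allows [rank_reduced_eq3] to decide conditions (a) and (b) by cases. *)
Lemma tangent23P p q r :
  reflect (tangent23 p q r)
    ((q == 0) && (r == 0) || (p + q == 0) && (q + r == 0)).
Proof.
apply: (iffP orP) => -[].
- by move=> /andP[/eqP q0 /eqP r0]; left.
- by move=> /andP[/eqP pq /eqP qr]; right.
- by move=> [q0 r0]; left; rewrite q0 r0 eqxx.
- by move=> [pq qr]; right; rewrite pq qr eqxx.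
Qed.

Lemma rank_reduced_eq3 p q r t u v : gram p q r t u v != 0 ->
  \rank (reduced_mx p q r t u v) = 3%N <->
  cond_a p q r t u v \/ cond_b p q r t u.
Proof.
move=> g0; split=> [rk3|ab]; last first.
  apply/eqP; rewrite eqn_leq rank_reduced_ge3 // andbT.
  by case: ab; [exact: rank_reduced_le3_a|exact: rank_reduced_le3_b].
have [/and3P[/eqP h1 /eqP h2 /eqP h3]|na] := boolP [&& p * v - q * t == 0,
    cross1 p q r == 0 & cross1 p t u == 0]; first by left.
have [/andP[/tangent23P h1 /tangent23P h2]|nb] := boolP
  (((q == 0) && (r == 0) || (p + q == 0) && (q + r == 0)) &&
   ((t == 0) && (u == 0) || (p + t == 0) && (t + u == 0))); first by right.
have := @rank_reduced_ge4 p q r t u v g0; rewrite rk3 => h.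
suff : (4 <= 3)%N by []; apply: h => [[h1 h2 h3]|[/tangent23P T1 /tangent23P T2]].
  by move: na; rewrite h1 h2 h3 eqxx.
by rewrite T1 T2 in nb.
Qed.

Lemma rank_reduced_le4 p q r t u v :
  (\rank (reduced_mx p q r t u v) <= 4)%N <->
  (p * v - q * t) * (q * (p + q) * (t + u) - t * (p + t) * (q + r)) = 0.
Proof.
have n2 : (- 2 : K) != 0 by rewrite oppr_eq0 pnatr_eq0.
have -> : (\rank (reduced_mx p q r t u v) <= 4)%N =
    (\det (reduced_mx p q r t u v) == 0).
  have := row_free_unit (reduced_mx p q r t u v).
  rewrite unitmxE unitfE /row_free => e.
  by rewrite -[RHS]negbK -e neq_ltn ltnS [(5 < _)%N]ltnNge rank_leq_row orbF.
rewrite det_reduced_mx; split=> [/eqP e|e].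
  by apply: (mulIf_eq0 n2); rewrite -e mulrA.
by rewrite -mulrA e mulr0.
Qed.

(** The expression is [(t + u) * cross1 p q r - (q + r) * cross1 p t u], where the terms in
    [p * (q + r) * (t + u)] cancel. *)
Lemma cross1_delta2 p q r t u : cross1 p q r = 0 -> cross1 p t u = 0 ->
  q * (p + q) * (t + u) - t * (p + t) * (q + r) = 0.
Proof.
rewrite /cross1 => c1 c2.
by apply: (eq_by_diff (eqD (eqM (t + u) c1) (eqM (- (q + r)) c2))); ring.
Qed.

End ReducedSystem.

(** * Cubics as trilinear forms and eigenpoints *)

Lemma ord3P (i : 'I_3) : [\/ i = ix, i = iy | i = iz].
Proof.
by case: i => -[|[|[|//]]] i3; [apply: Or31|apply: Or32|apply: Or33]; apply: val_inj.
Qed.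

Lemma bilC (K : fieldType) (P Q : 'rV[K]_3) : bil P Q = bil Q P.
Proof. by rewrite /bil; ring. Qed.

Section Polarization.

Variable K : numFieldType.
Implicit Types (a b c P : 'rV[K]_3) (w : 'rV[K]_10).

(** Listed in the order of [cubic_monomials], so that positions match the columns of [Phi]. *)
Definition monomial_indices : seq ('I_3 * 'I_3 * 'I_3) :=
  [:: (ix, ix, ix); (ix, ix, iy); (ix, iy, iy); (iy, iy, iy); (ix, ix, iz);
      (ix, iy, iz); (iy, iy, iz); (ix, iz, iz); (iy, iz, iz); (iz, iz, iz)].

Definition polar_monomial (ijk : 'I_3 * 'I_3 * 'I_3) a b c : K :=
  let: (i, j, k) := ijk in
  a 0 i * b 0 j * c 0 k + a 0 i * b 0 k * c 0 j + a 0 j * b 0 i * c 0 k +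
  a 0 j * b 0 k * c 0 i + a 0 k * b 0 i * c 0 j + a 0 k * b 0 j * c 0 i.

(* For the cubic form f with coefficient vector w this is 6 times the symmetric
   trilinear form with diagonal f. *)
Definition polar w a b c : K :=
  \sum_(m < 10) w 0 m * polar_monomial (nth (ix, ix, ix) monomial_indices m) a b c.

Lemma polarC w a b c : polar w a b c = polar w b a c.
Proof.
by apply: eq_bigr => m _; case: (nth _ _ _) => -[i j] k /=; congr (_ * _); ring.
Qed.

Lemma polarCA w a b c : polar w a b c = polar w a c b.
Proof.
by apply: eq_bigr => m _; case: (nth _ _ _) => -[i j] k /=; congr (_ * _); ring.
Qed.

Lemma polar_linear w b c (x y : K) a a' :
  polar w (x *: a + y *: a') b c = x * polar w a b c + y * polar w a' b c.
Proof.
rewrite /polar !mulr_sumr -big_split; apply: eq_bigr => m _ /=.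
by case: (nth _ _ _) => -[i j] k /=; rewrite !mxE; ring.
Qed.

Definition basis_vec (k : 'I_3) : 'rV[K]_3 := delta_mx 0 k.

Lemma evalp_mderivX (m : 'X_{1..3}) i P :
  evalp ('X_[m])^`M(i) P =
  (m i)%:R * (P 0 ix ^+ (m ix - (i == ix)) * P 0 iy ^+ (m iy - (i == iy)) *
              P 0 iz ^+ (m iz - (i == iz))).
Proof.
rewrite /evalp mderivX mevalZ mevalX !big_ord_recl big_ord0 mulr1 mulrA.
rewrite !mnmBE !mnm1E.
have -> : lift ord0 ord0 = iy by apply: val_inj.
have -> : lift ord0 (lift ord0 ord0) = iz by apply: val_inj.
by have -> : ord0 = ix by apply: val_inj.
Qed.

Definition cross_index (i : 'I_3) : 'I_3 * 'I_3 :=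
  nth (ix, iy) [:: (ix, iy); (ix, iz); (iy, iz)] i.

(** Polarization with both other slots at [P] gives twice a partial derivative at [P], hence the
    factor 2; verified for each monomial. *)
Lemma Phi_entry P i j (ab := cross_index i) :
  2 * Phi P i j =
  P 0 ab.1 * polar_monomial (nth (ix, ix, ix) monomial_indices j) P P (basis_vec ab.2) -
  P 0 ab.2 * polar_monomial (nth (ix, ix, ix) monomial_indices j) P P (basis_vec ab.1).
Proof.
rewrite mxE {}/ab.
case: i => -[|[|[|//]]] i3; rewrite (tnth_nth 0) /= /evalp mevalB !mevalM !mevalXU
  -!/(evalp _ _) !evalp_mderivX;
 case: j => -[|[|[|[|[|[|[|[|[|[|//]]]]]]]]]] j10; rewrite (tnth_nth 0%MM) /=
  !multinomE !(tnth_nth 0%N) /= !mxE /=; ring.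
Qed.

Lemma polar_sum3 w a b (x y z : K) c d e :
  polar w a b (x *: c + y *: d + z *: e) =
  x * polar w a b c + y * polar w a b d + z * polar w a b e.
Proof.
have C u : polar w a b u = polar w u a b by rewrite polarCA polarC.
by rewrite !C -[X in X + z *: e]scale1r !polar_linear mul1r.
Qed.

Lemma rV3_basis (c : 'rV[K]_3) :
  c = c 0 ix *: basis_vec ix + c 0 iy *: basis_vec iy + c 0 iz *: basis_vec iz.
Proof.
by apply/rowP => -[[|[|[|//]]] k3]; rewrite !mxE /= ?(mulr0, mulr1, addr0, add0r);
  congr (c _ _); apply: val_inj.
Qed.

Definition eigenpoint w P : Prop :=
  exists l : K, forall c, polar w P P c = l * bil P c.

Lemma Phi_mul w P i (ab := cross_index i) :
  2 * (Phi P *m w^T) i 0 = P 0 ab.1 * polar w P P (basis_vec ab.2) -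
    P 0 ab.2 * polar w P P (basis_vec ab.1).
Proof.
rewrite mxE /polar !mulr_sumr -sumrB; apply: eq_bigr => j _.
by rewrite mulrA Phi_entry mxE -/ab; ring.
Qed.

(** The entries of [Phi P *m w^T] are the 2 by 2 minors of [P] and the gradient at [P]. They vanish
    exactly when the gradient is a multiple of [P]; the multiplier is read off at a nonzero
    coordinate of [P]. *)
Lemma Phi_ker w P : P != 0 -> Phi P *m w^T = 0 <-> eigenpoint w P.
Proof.
move=> P0; have n2 : (2 : K) != 0 by rewrite pnatr_eq0.
split=> [h|[l hl]]; last first.
  apply/matrixP => i j; rewrite ord1 [RHS]mxE; apply: (mulIf_eq0 n2).
  rewrite Phi_mul !hl; case: i => -[|[|[|//]]] i3;
    by rewrite /cross_index /bil !mxE /=; ring.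
have E i := etrans (esym (Phi_mul w P i)) (congr1 (fun A : 'M_(3,1) => 2 * A i 0) h).
have [k Pk] : exists k, P 0 k != 0 by apply/rV0Pn.
have prop i j : P 0 i * polar w P P (basis_vec j) = P 0 j * polar w P P (basis_vec i).
  have e1 := E ix; have e2 := E iy; have e3 := E iz.
  rewrite /cross_index !mxE mulr0 /= in e1 e2 e3.
  move/eqP: e1; rewrite subr_eq0 => /eqP e1.
  move/eqP: e2; rewrite subr_eq0 => /eqP e2.
  move/eqP: e3; rewrite subr_eq0 => /eqP e3.
  by case: (ord3P i) => ->; case: (ord3P j) => ->.
exists (polar w P P (basis_vec k) / P 0 k) => c.
have G j : polar w P P (basis_vec j) = polar w P P (basis_vec k) / P 0 k * P 0 j.
  by apply: (mulfI Pk); rewrite prop; field.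
by rewrite {1}(rV3_basis c) polar_sum3 (G ix) (G iy) (G iz) /bil; ring.
Qed.

Lemma eigenpointZ w P (k : K) : k != 0 -> eigenpoint w (k *: P) <-> eigenpoint w P.
Proof.
move=> k0.
have C c : polar w (k *: P) (k *: P) c = k ^+ 2 * polar w P P c.
  have Z a b d : polar w (k *: a) b d = k * polar w a b d.
    by rewrite -[k *: a]addr0 -(scale0r a) polar_linear mul0r addr0.
  by rewrite Z polarC Z mulrA.
have B c : bil (k *: P) c = k * bil P c by rewrite /bil !mxE; ring.
split=> -[l hl].
  by exists (l / k) => c; apply: (mulfI (expf_neq0 2 k0)); rewrite -C hl B; field.
by exists (k * l) => c; rewrite C hl B; ring.
Qed.

End Polarization.

(** * From eigenforms to solutions of the reduced system *)

Section KernelTransfer.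

Variable K : numFieldType.
Variables B : 'I_3 -> 'rV[K]_3.
Hypothesis B_unit : \matrix_i B i \in unitmx.
Implicit Types (w : 'rV[K]_10) (l : 'rV[K]_5).

Lemma linear_eq0_on_basis (h : 'rV[K]_3 -> K) :
  (forall x y z a b c, h (x *: a + y *: b + z *: c) = x * h a + y * h b + z * h c) ->
  (forall i, h (B i) = 0) -> forall c, h c = 0.
Proof.
move=> hlin h0 c; rewrite -[c](mulmxKV B_unit) mulmx_sum_row !big_ord_recl big_ord0.
by rewrite addr0 addrA hlin !rowK !h0 !mulr0 !addr0.
Qed.

Definition polar_coord_mx : 'M[K]_10 :=
  \matrix_(m, n) let: (i, j, k) := nth (ix, ix, ix) monomial_indices n in
    polar_monomial (nth (ix, ix, ix) monomial_indices m) (B i) (B j) (B k).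

Lemma polar_coordE w n : (w *m polar_coord_mx) 0 n =
  let: (i, j, k) := nth (ix, ix, ix) monomial_indices n in polar w (B i) (B j) (B k).
Proof.
by rewrite mxE; case E: (nth _ _ n) => [[i j] k]; apply: eq_bigr => m _; rewrite mxE E.
Qed.

(** Evaluating at the basis vectors of one monomial isolates its coefficient, times 6, 2 or 1, which
    is nonzero in characteristic zero. *)
Lemma polar_eq0 w : (forall a b c, polar w a b c = 0) -> w = 0.
Proof.
move=> h; apply/rowP => n; rewrite mxE.
have := h (basis_vec K (nth (ix, ix, ix) monomial_indices n).1.1)
  (basis_vec K (nth (ix, ix, ix) monomial_indices n).1.2)
  (basis_vec K (nth (ix, ix, ix) monomial_indices n).2).
rewrite /polar (bigD1 n) //= big1 => [|m mn]; last first.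
  case: m mn => -[|[|[|[|[|[|[|[|[|[|//]]]]]]]]]] m10;
  case: n => -[|[|[|[|[|[|[|[|[|[|//]]]]]]]]]] n10 //= _; rewrite !mxE /=; ring.
rewrite addr0 => /eqP; rewrite mulf_eq0 => /orP[/eqP //|].
case: n => -[|[|[|[|[|[|[|[|[|[|//]]]]]]]]]] n10; rewrite /= !mxE /=
  ?(mulr0, mulr1, mul0r, addr0, add0r) -?natrD; rewrite ?pnatr_eq0 //.
Qed.

(** By symmetry the ten values give the form on all triples from [B]; extending linearly one slot at
    a time shows that they determine it. *)
Lemma polar_coord_unit : polar_coord_mx \in unitmx.
Proof.
rewrite -row_free_unit; apply: inj_row_free => w wL.
have L n := etrans (esym (polar_coordE w n)) (congr1 (fun A : 'rV_10 => A 0 n) wL).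
have {}L n (n10 : (n < 10)%N) := L (Ordinal n10).
have BBB i j k : polar w (B i) (B j) (B k) = 0.
  have := (L 0 isT, L 1 isT, L 2 isT, L 3 isT, L 4 isT,
           L 5 isT, L 6 isT, L 7 isT, L 8 isT, L 9 isT)%N.
  rewrite !mxE /= => -[[[[[[[[[L0 L1] L2] L3] L4] L5] L6] L7] L8] L9].
  case: (ord3P i) => ->; case: (ord3P j) => ->; case: (ord3P k) => -> //;
    by [rewrite polarC|rewrite polarCA|rewrite polarC polarCA|
        rewrite polarCA polarC|rewrite polarC polarCA polarC].
apply: polar_eq0 => a b c.
have {BBB} BB i j d : polar w (B i) (B j) d = 0.
  apply: (linear_eq0_on_basis (h := polar w (B i) (B j))) => [*|k].
    exact: polar_sum3.
  exact: BBB.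
have {BB} BB i d e : polar w (B i) d e = 0.
  apply: (linear_eq0_on_basis (h := fun d => polar w (B i) d e)) => [*|k].
    by rewrite !(polarCA _ _ _ e) polar_sum3.
  exact: BB.
rewrite polarC polarCA.
apply: (linear_eq0_on_basis (h := polar w b c)) => [*|k].
  exact: polar_sum3.
by rewrite polarCA polarC.
Qed.

Lemma eigenvalue_on_basis w P x :
  (forall i, polar w P P (B i) = x * bil P (B i)) ->
  forall c, polar w P P c = x * bil P c.
Proof.
move=> h c; apply/eqP; rewrite -subr_eq0; apply/eqP; move: c.
apply: (linear_eq0_on_basis (h := fun c => polar w P P c - x * bil P c)) => [*|i].
  by rewrite polar_sum3 /bil !mxE; ring.
by rewrite h subrr.
Qed.

Let p := bil (B ix) (B ix).
Let q := bil (B ix) (B iy).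
Let r := bil (B iy) (B iy).
Let t := bil (B ix) (B iz).
Let u := bil (B iz) (B iz).
Let v := bil (B iy) (B iz).

Lemma gram_neq0 : gram p q r t u v != 0.
Proof.
pose b i j := nth 0 (nth [::] [:: [:: p; q; t]; [:: q; r; v]; [:: t; v; u]] i) j.
have G : \matrix_i B i *m (\matrix_i B i)^T = \matrix_(i < 3, j < 3) b i j.
  have E i j : (\matrix_i B i *m (\matrix_i B i)^T) i j = bil (B i) (B j).
    rewrite mxE !big_ord_recl big_ord0 addr0 !mxE /bil addrA.
    by congr (_ * _ + _ * _ + _ * _); congr (B _ _ _); apply: val_inj.
  apply/matrixP => i j; rewrite E mxE.
  by case: (ord3P i) => ->; case: (ord3P j) => -> //; rewrite bilC.
have d : \det (\matrix_(i < 3, j < 3) b i j) = gram p q r t u v.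
  by rewrite det_laplace /= /b /gram /=; ring.
rewrite -d -G det_mulmx det_tr mulf_neq0 //; by rewrite -unitfE -unitmxE.
Qed.

(* The polar values of an eigenform at triples of basis vectors, as functions of
   the multipliers at B0, B1, B0 + B1, B2, B0 + B2; the value at (B0, B1, B2) is
   read off the eigenpoint equation at B0 + B1 paired with B2. *)
Definition multiplier_rows : seq (seq K) :=
  [:: [:: p; 0; 0; 0; 0]; [:: q; 0; 0; 0; 0]; [:: 0; q; 0; 0; 0]; [:: 0; r; 0; 0; 0];
      [:: t; 0; 0; 0; 0]; [:: - t / 2; - v / 2; (t + v) / 2; 0; 0];
      [:: 0; v; 0; 0; 0]; [:: 0; 0; 0; t; 0]; [:: 0; 0; 0; v; 0]; [:: 0; 0; 0; u; 0]].

Definition multiplier_mx : 'M[K]_(5, 10) :=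
  \matrix_(k, n) nth 0 (nth [::] multiplier_rows n) k.

Definition eigenpoints w : Prop :=
  [/\ eigenpoint w (B ix), eigenpoint w (B iy), eigenpoint w (B ix + B iy),
      eigenpoint w (B iz) & eigenpoint w (B ix + B iz)].

Lemma multiplier_mxE l n : (l *m multiplier_mx) 0 n =
  \sum_(k < 5) l 0 (inord k) * nth 0 (nth [::] multiplier_rows n) k.
Proof. by rewrite mxE; apply: eq_bigr => k _; rewrite mxE inord_val. Qed.

(** Expanding the form at the two sums turns their eigenpoint equations into the reduced system plus
    a formula for the value at the three distinct basis vectors. Conversely, [eigenvalue_on_basis]
    reduces each eigenpoint condition to three equations. *)
Lemma eigenpointsP w : eigenpoints w <->
  exists l, l *m reduced_mx p q r t u v = 0 /\
    w *m polar_coord_mx = l *m multiplier_mx.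
Proof.
have n2 : (2 : K) != 0 by rewrite pnatr_eq0.
have bilDl P Q c : bil (P + Q) c = bil P c + bil Q c :> K by rewrite /bil !mxE; ring.
have polD a b c : polar w (a + b) (a + b) c =
    polar w a a c + 2 * polar w a b c + polar w b b c.
  have D e f g : polar w (e + f) g c = polar w e g c + polar w f g c.
    by rewrite -[e]scale1r -[f]scale1r polar_linear !mul1r !scale1r.
  by rewrite D !(polarC _ _ (a + b)) !D (polarC _ b a); ring.
have rot a b : polar w a b a = polar w a a b by rewrite polarCA.
have rot' a b : polar w a b b = polar w b b a by rewrite polarC polarCA.
split.
  move=> [[l0 h0] [l1 h1] [l2 h2] [l3 h3] [l4 h4]].
  have h2x := h2 (B ix); have h2y := h2 (B iy); have h2z := h2 (B iz).
  have h4x := h4 (B ix); have h4y := h4 (B iy); have h4z := h4 (B iz).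
  rewrite !polD !bilDl ?(polarCA w (B ix) (B iz) (B iy)) ?rot ?rot' !(h0, h1, h3)
    ?(bilC (B iy) (B ix)) ?(bilC (B iz) (B ix)) ?(bilC (B iz) (B iy))
    in h2x h2y h2z h4x h4y h4z.
  rewrite -/p -/q -/r -/t -/u -/v in h2x h2y h2z h4x h4y h4z.
  exists (\row_(k < 5) nth 0 [:: l0; l1; l2; l3; l4] k); split.
    apply: reduced_mx_ker; split; [split|split|] => /=.
    - by apply: (eq_by_diff h2x); ring.
    - by apply: (eq_by_diff h2y); ring.
    - by apply: (eq_by_diff h4x); ring.
    - by apply: (eq_by_diff h4z); ring.
    - by apply: (eq_by_diff (eqD h2z (eqM (-1) h4y))); ring.
  apply/rowP => n; rewrite polar_coordE multiplier_mxE
    (sum_ord5 (fun k => (\row_(k < 5) nth 0 [:: l0; l1; l2; l3; l4] k) 0 (inord k) *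
      nth 0 (nth [::] multiplier_rows n) k)) !mxE !inordK //.
  case: n => -[|[|[|[|[|[|[|[|[|[|//]]]]]]]]]] n10 /=;
    rewrite ?rot' ?(h0, h1, h3) ?(bilC (B iy) (B ix)) ?(bilC (B iz) (B ix))
      ?(bilC (B iz) (B iy)) -/p -/q -/r -/t -/u -/v; try ring.
  by apply: (mulfI n2); apply: (eq_by_diff h2z); field.
move=> [l [/reduced_mxP [[e1 e2] [e3 e4] e5] wL]].
have {}wL n (n10 : (n < 10)%N) : \sum_(k < 5) l 0 (inord k) * nth 0 (nth [::] multiplier_rows n) k =
    let: (i, j, k) := nth (ix, ix, ix) monomial_indices n in polar w (B i) (B j) (B k).
  by rewrite -(polar_coordE w (Ordinal n10)) wL multiplier_mxE.
have {}wL n n10 := etrans (esym (wL n n10))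
  (sum_ord5 (fun k => l 0 (inord k) * nth 0 (nth [::] multiplier_rows n) k)).
have := (wL 0 isT, wL 1 isT, wL 2 isT, wL 3 isT, wL 4 isT,
         wL 5 isT, wL 6 isT, wL 7 isT, wL 8 isT, wL 9 isT)%N.
rewrite /= => -[[[[[[[[[L0 L1] L2] L3] L4] L5] L6] L7] L8] L9].
split; [exists (l 0 (inord 0))|exists (l 0 (inord 1))|exists (l 0 (inord 2))|
        exists (l 0 (inord 3))|exists (l 0 (inord 4))];
  apply: eigenvalue_on_basis => i; case: (ord3P i) => ->;
  rewrite ?polD ?bilDl ?(polarCA w (B ix) (B iz) (B iy)) ?rot ?rot'
    ?(bilC (B iy) (B ix)) ?(bilC (B iz) (B ix)) ?(bilC (B iz) (B iy))
    -/p -/q -/r -/t -/u -/v.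
all: rewrite rot' in L2; rewrite rot' in L7; rewrite rot' in L8.
all: rewrite ?(L0, L1, L2, L3, L4, L5, L6, L7, L8, L9); try ring.
- by apply: (eq_by_diff e1); ring.
- by apply: (eq_by_diff e2); ring.
- by field.
- by apply: (eq_by_diff e3); ring.
- by apply: (eq_by_diff (eqM (-1) e5)); field.
- by apply: (eq_by_diff e4); ring.
Qed.

(** For the zero form a multiplier times the pairings of its point with the basis is zero, and the
    bilinear form is nondegenerate. The coefficients used are cofactors of the Gram matrix. *)
Lemma multiplier_mx_ker l : l *m reduced_mx p q r t u v = 0 ->
  l *m multiplier_mx = 0 -> l = 0.
Proof.
move=> /reduced_mxP [[e1 e2] [e3 e4] e5] lS.
have L n (n10 : (n < 10)%N) : \sum_(k < 5) l 0 (inord k) * nth 0 (nth [::] multiplier_rows n) k = 0.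
  by rewrite -(multiplier_mxE l (Ordinal n10)) lS mxE.
have {}L n n10 := etrans (esym (sum_ord5 (fun k =>
  l 0 (inord k) * nth 0 (nth [::] multiplier_rows n) k))) (L n n10).
have g0 := gram_neq0.
have := (L 0 isT, L 1 isT, L 2 isT, L 3 isT, L 4 isT,
         L 5 isT, L 6 isT, L 7 isT, L 8 isT, L 9 isT)%N.
rewrite /= !mulr0 !addr0 !add0r => -[[[[[[[[[L0 L1] L2] L3] L4] L5] L6] L7] L8] L9].
have l0 : l 0 (inord 0) = 0.
  apply: (mulIf_eq0 g0).
  apply: (eq_by_diff (eqD (eqD
    (eqM (r * u - v ^+ 2) L0)
    (eqM (- (q * u - v * t)) L1))
    (eqM (q * v - r * t) L4))).
  by rewrite /gram; ring.
have l1 : l 0 (inord 1) = 0.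
  apply: (mulIf_eq0 g0).
  apply: (eq_by_diff (eqD (eqD
    (eqM (p * u - t ^+ 2) L3)
    (eqM (- (q * u - v * t)) L2))
    (eqM (- (p * v - q * t)) L6))).
  by rewrite /gram; ring.
have l3 : l 0 (inord 3) = 0.
  apply: (mulIf_eq0 g0).
  apply: (eq_by_diff (eqD (eqD
    (eqM (p * r - q ^+ 2) L9)
    (eqM (- (p * v - q * t)) L8))
    (eqM (q * v - r * t) L7))).
  by rewrite /gram; ring.
rewrite l0 l1 l3 in e1 e2 e3 e4 e5 L5.
rewrite !mul0r ?add0r in L5.
have n2 : (2 : K) != 0 by rewrite pnatr_eq0.
have L5' : l 0 (inord 2) * (t + v) = 0 by apply: (mulIf_eq0 (invr_neq0 n2)); rewrite -L5; ring.
have l2 : l 0 (inord 2) = 0.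
  apply: (mulIf_eq0 g0).
  apply: (eq_by_diff (eqD (eqD
    (eqM (- (r * u - v ^+ 2)) e1)
    (eqM (q * u - v * t) e2))
    (eqM (q * v - r * t) L5'))).
  by rewrite /gram; ring.
have l4 : l 0 (inord 4) = 0.
  rewrite l2 in e5; apply: (mulIf_eq0 g0).
  apply: (eq_by_diff (eqD (eqD
    (eqM (- (r * u - v ^+ 2)) e3)
    (eqM (- (q * u - v * t)) e5))
    (eqM (- (q * v - r * t)) e4))).
  by rewrite /gram; ring.
apply/rowP => k; rewrite mxE -(inord_val k).
by case: k => -[|[|[|[|[|//]]]]] k5.
Qed.

(** The space of eigenforms is isomorphic to the left kernel of the reduced matrix, so
    [10 - \rank A] equals 5 minus the rank of that matrix. *)
Lemma rank_of_eigenpoints m (A : 'M[K]_(m, 10)) :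
  (forall w, A *m w^T = 0 <-> eigenpoints w) ->
  \rank A = (5 + \rank (reduced_mx p q r t u v))%N.
Proof.
move=> hA; set M := reduced_mx p q r t u v.
have hA' w : w *m A^T = 0 <-> eigenpoints w.
  by rewrite -hA; split=> /(congr1 trmx); rewrite trmx_mul trmxK trmx0.
have eqk : (kermx A^T *m polar_coord_mx :=: kermx M *m multiplier_mx)%MS.
  apply/eqmxP/andP; split; apply/rV_subP => x /submxP[D ->]; rewrite mulmxA.
    have /hA'/eigenpointsP [l [lM ->]] : D *m kermx A^T *m A^T = 0.
      by rewrite -mulmxA mulmx_ker mulmx0.
    by apply: submxMr; apply/sub_kermxP.
  set l := D *m kermx M.
  have lM : l *m M = 0 by rewrite -mulmxA mulmx_ker mulmx0.
  rewrite -[l *m _](mulmxKV polar_coord_unit); apply: submxMr; apply/sub_kermxP.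
  apply/hA'/eigenpointsP; exists l; split=> //.
  by rewrite mulmxKV // polar_coord_unit.
have capk : (kermx M :&: kermx multiplier_mx = 0)%MS.
  apply/eqP/rowV0P => l; rewrite sub_capmx => /andP[/sub_kermxP lM /sub_kermxP lS].
  exact: multiplier_mx_ker.
have := mxrank_mul_ker (kermx M) multiplier_mx.
rewrite capk mxrank0 addn0 -eqk mxrankMfree ?row_free_unit ?polar_coord_unit //.
rewrite !mxrank_ker mxrank_tr => e.
have := rank_leq_col A; have := rank_leq_row M; move: e.
by move: (\rank A) (\rank M) => a b; lia.
Qed.

End KernelTransfer.

(** * V-configurations *)

Section Configuration.

Variable K : numFieldType.
Implicit Types P Q S : 'rV[K]_3.

Lemma rank_join_line P Q : P != 0 -> Q != 0 -> ~~ same_point P Q ->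
  \rank (join_line P Q) = 2%N.
Proof.
move=> P0 Q0 PQ; apply/eqP; rewrite eqn_leq; apply/andP; split.
  by apply: leq_trans (mxrank_adds_leqif P Q) _; rewrite !rank_rV P0 Q0.
suff /rank_ltmx : (Q < join_line P Q)%MS by rewrite rank_rV Q0.
rewrite ltmxE addsmxSr /=; apply: contra PQ => h.
have PleQ : (P <= Q)%MS := submx_trans (addsmxSl P Q) h.
rewrite /same_point PleQ /=.
by have := mxrank_leqif_sup PleQ; rewrite !rank_rV P0 Q0 => -[_ <-].
Qed.

Lemma aligned_sub_join P Q S : \rank (join_line P Q) = 2%N ->
  aligned P Q S -> (S <= join_line P Q)%MS.
Proof.
move=> rPQ [L [/eqP rL [PL QL SL]]].
have PQL : (join_line P Q <= L)%MS by rewrite addsmx_sub PL QL.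
apply: submx_trans SL _.
by have := mxrank_leqif_sup PQL; rewrite rPQ rL => -[_ <-].
Qed.

Lemma sub_joinP P Q S : (S <= join_line P Q)%MS -> exists a b, S = a *: P + b *: Q.
Proof.
case/sub_addsmxP => -[u v] /= ->; exists (u 0 0), (v 0 0).
by rewrite -!mul_scalar_mx -!mx11_scalar.
Qed.

Lemma same_pointZ P (k : K) : k != 0 -> same_point P (k *: P).
Proof. by move=> k0; rewrite /same_point !(eqmx_scale P k0) submx_refl. Qed.

(** Both coefficients of [S] on [P] and [Q] are nonzero, as [S] is a different point from each;
    absorbing their ratio into [Q] makes [S] proportional to a sum. *)
Lemma aligned_rescale P Q S : P != 0 -> Q != 0 -> S != 0 -> ~~ same_point P Q ->
  ~~ same_point P S -> ~~ same_point Q S -> aligned P Q S ->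
  exists a b, [/\ a != 0, b != 0 & S = a *: (P + b *: Q)].
Proof.
move=> P0 Q0 S0 PQ PS QS /(aligned_sub_join (rank_join_line P0 Q0 PQ)) /sub_joinP[a [b e]].
have a0 : a != 0.
  apply: contraNneq QS => a0; rewrite e a0 scale0r add0r same_pointZ //.
  by apply: contraNneq S0 => b0; rewrite e a0 b0 !scale0r addr0.
have b0 : b != 0.
  apply: contraNneq PS => b0; rewrite e b0 scale0r addr0 same_pointZ //.
exists a, (b / a); split=> //; first by rewrite mulf_neq0 ?invr_eq0.
by rewrite scalerDr scalerA mulrCA mulfV // mulr1.
Qed.

Definition frame P Q S (i : 'I_3) : 'rV[K]_3 := nth 0 [:: P; Q; S] i.

Lemma frame_unit P Q S (a b : K) : a != 0 -> b != 0 ->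
  \rank (join_line P Q) = 2%N -> ~~ (S <= join_line P Q)%MS ->
  \matrix_i frame P (a *: Q) (b *: S) i \in unitmx.
Proof.
move=> a0 b0 rPQ SPQ; rewrite -row_full_unit -col_leq_rank.
set T := \matrix_i _.
have rT i : (frame P (a *: Q) (b *: S) i <= T)%MS.
  by rewrite -(rowK (frame P (a *: Q) (b *: S)) i) row_sub.
have sT : (join_line P Q + S <= T)%MS.
  rewrite !addsmx_sub (rT ix) -(eqmx_scale Q a0) (rT iy) -(eqmx_scale S b0).
  exact: (rT iz).
suff /rank_ltmx : (join_line P Q < join_line P Q + S)%MS.
  by rewrite rPQ => h; apply: leq_trans h (mxrankS sT).
by rewrite ltmxE addsmxSl addsmx_sub submx_refl.
Qed.

(** * Tangency to the isotropic conic *)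

Lemma evalp_mderiv_Qiso i P : evalp (Qiso K)^`M(i) P = 2 * P 0 i.
Proof.
rewrite /evalp /Qiso !expr2 !mderivD !mderivM !mevalD !mevalM !mevalXU
  -!/(evalp _ _) !evalp_mderivX !mnm1E.
by case: (ord3P i) => -> /=; ring.
Qed.

(** The tangent line at [S] is the orthogonal of [S], of rank 2 like the join, so inclusion suffices
    for equality. That [S] lies on the conic follows because [S] is itself on the join. *)
Lemma tangent_join_line P Q S : \rank (join_line P Q) = 2%N -> S != 0 ->
  (S <= join_line P Q)%MS ->
  tangent_Qiso (join_line P Q) S <-> bil P S = 0 /\ bil Q S = 0.
Proof.
move=> rPQ S0 SPQ.
have n2 : (2 : K) != 0 by rewrite pnatr_eq0.
have gE : \col_(i < 3) evalp (Qiso K)^`M(i) S = 2 *: S^T.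
  by apply/colP => i; rewrite !mxE evalp_mderiv_Qiso.
have tE X : (X <= tangent_line (Qiso K) S)%MS = (bil X S == 0).
  have bE : (X *m S^T) 0 0 = bil X S.
    rewrite mxE !big_ord_recl big_ord0 addr0 !mxE /bil addrA.
    by congr (_ * _ + _ * _ + _ * _); congr (_ _ _); apply: val_inj.
  rewrite /tangent_line gE; apply/sub_kermxP/eqP => [/matrixP/(_ 0 0)|e].
    by rewrite -scalemxAr !mxE => /(mulIf_eq0 n2) e; rewrite -bE mxE.
  by apply/matrixP => i j; rewrite !ord1 -scalemxAr mxE bE e mulr0 mxE.
have rT : \rank (tangent_line (Qiso K) S) = 2%N.
  by rewrite /tangent_line mxrank_ker gE -mxrank_tr linearZ /= trmxK mxrank_scale_nz // rank_rV S0.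
split=> [[_ _ /andP[+ _]]|[PS QS]].
  by rewrite addsmx_sub !tE => /andP[/eqP-> /eqP->].
have sub : (join_line P Q <= tangent_line (Qiso K) S)%MS.
  by rewrite addsmx_sub !tE PS QS eqxx.
have SS : bil S S = 0 by apply/eqP; rewrite -tE (submx_trans SPQ).
split; first by rewrite /is_line rPQ.
  by rewrite -[RHS]SS /evalp /Qiso !expr2 !mevalD !mevalM !mevalXU.
rewrite sub /=.
by have := mxrank_leqif_sup sub; rewrite rPQ rT => -[_ <-].
Qed.

Lemma Phi_stack_ker n (P : n.-tuple 'rV[K]_3) (w : 'rV_10) :
  Phi_stack P *m w^T = 0 <-> forall i, Phi (tnth P i) *m w^T = 0.
Proof.
rewrite mxcol_mul -(mxcol0 (p_ := fun _ => 3%N)).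
exact: iff_sym (eq_mxcolP _ _).
Qed.

Lemma scaled_eq0 (k x y : K) : k != 0 -> x = k * y -> x = 0 <-> y = 0.
Proof. by move=> k0 ->; split=> [/(mulIf_eq0 k0)|->]; rewrite ?mulr0. Qed.

Lemma tangent23_iff P Q (a k : K) : a != 0 -> k != 0 ->
  \rank (join_line P Q) = 2%N -> Q != 0 -> P + k *: Q != 0 ->
  tangent23 (bil P P) (bil P (k *: Q)) (bil (k *: Q) (k *: Q)) <->
  tangent_Qiso (join_line P Q) Q \/
  tangent_Qiso (join_line P Q) (a *: (P + k *: Q)).
Proof.
move=> a0 k0 rPQ Q0 S0.
have Qj : (Q <= join_line P Q)%MS by exact: addsmxSr.
have Sj : (a *: (P + k *: Q) <= join_line P Q)%MS.
  apply/scalemx_sub/addmx_sub; first exact: addsmxSl.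
  exact: scalemx_sub.
have aS0 : a *: (P + k *: Q) != 0 by rewrite scaler_eq0 negb_or a0.
have e1 : bil P (k *: Q) = k * bil P Q by rewrite /bil !mxE; ring.
have e2 : bil (k *: Q) (k *: Q) = k ^+ 2 * bil Q Q by rewrite /bil !mxE; ring.
have e3 : bil P (a *: (P + k *: Q)) = a * (bil P P + bil P (k *: Q)).
  by rewrite /bil !mxE; ring.
have e4 : k * bil Q (a *: (P + k *: Q)) = a * (bil P (k *: Q) + bil (k *: Q) (k *: Q)).
  by rewrite /bil !mxE; ring.
rewrite (tangent_join_line rPQ Q0 Qj) (tangent_join_line rPQ aS0 Sj) /tangent23.
rewrite (scaled_eq0 k0 e1) (scaled_eq0 (expf_neq0 2 k0) e2) -(scaled_eq0 a0 e3).
by rewrite -(scaled_eq0 a0 e4) (scaled_eq0 k0 (erefl (k * bil Q _))).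
Qed.

(* Up to nonzero factors, the invariants of a V-configuration are those of the
   Gram matrix of the rescaled vectors P1, P2, P4. *)
Lemma V_configuration_reduction P1 P2 P3 P4 P5 :
  V_configuration P1 P2 P3 P4 P5 -> exists p q r t u v : K,
  [/\ gram p q r t u v != 0,
      \rank (Phi_stack [tuple P1; P2; P3; P4; P5]) =
        (5 + \rank (reduced_mx p q r t u v))%N,
      p * v - q * t = 0 <-> delta1 P1 P2 P4 = 0,
      delta2 P1 P2 P3 P4 P5 = 0 <->
        q * (p + q) * (t + u) - t * (p + t) * (q + r) = 0
    & [/\ delta1bar P1 P2 P3 = 0 <-> cross1 p q r = 0,
          delta1bar P1 P4 P5 = 0 <-> cross1 p t u = 0,
          tangent23 p q r <-> tangent_Qiso (join_line P1 P2) P2 \/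
                              tangent_Qiso (join_line P1 P2) P3
        & tangent23 p t u <-> tangent_Qiso (join_line P1 P4) P4 \/
                              tangent_Qiso (join_line P1 P4) P5]].
Proof.
case=> /= /and5P[p1 p2 p3 p4 /andP[p5 _]].
case/and5P => /and5P[d12 d13 d14 d15 _] /and4P[d23 d24 d25 _] /and3P[d34 d35 _] /andP[d45 _] _.
move=> al123 al145 nal124.
have r12 : \rank (join_line P1 P2) = 2%N by exact: rank_join_line.
have r14 : \rank (join_line P1 P4) = 2%N by exact: rank_join_line.
have [a [k [a0 k0 P3E]]] := aligned_rescale p1 p2 p3 d12 d13 d23 al123.
have [c [m [c0 m0 P5E]]] := aligned_rescale p1 p4 p5 d14 d15 d45 al145.
have P4n : ~~ (P4 <= join_line P1 P2)%MS.
  apply/negP => h; apply: nal124; exists (join_line P1 P2).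
  by rewrite /is_line r12 h addsmxSl addsmxSr.
have B_unit := frame_unit k0 m0 r12 P4n.
set B := frame P1 (k *: P2) (m *: P4) in B_unit.
have B12 : B ix + B iy != 0 by apply: contraNneq p3 => e;
  rewrite P3E -[P1 + _]/(B ix + B iy) e scaler0.
have B14 : B ix + B iz != 0 by apply: contraNneq p5 => e;
  rewrite P5E -[P1 + _]/(B ix + B iz) e scaler0.
have := rank_of_eigenpoints B_unit (A := Phi_stack [tuple P1; P2; P3; P4; P5]).
have := gram_neq0 B_unit.
set p := bil (B ix) (B ix); set q := bil (B ix) (B iy); set r := bil (B iy) (B iy).
set t := bil (B ix) (B iz); set u := bil (B iz) (B iz); set v := bil (B iy) (B iz).
move=> g0 rkE.
have {}rkE : \rank (Phi_stack [tuple P1; P2; P3; P4; P5]) = (5 + \rank (reduced_mx p q r t u v))%N.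
  apply: rkE => w; rewrite Phi_stack_ker.
  have f1 : Phi P1 *m w^T = 0 <-> eigenpoint w (B ix) by exact: Phi_ker.
  have f2 : Phi P2 *m w^T = 0 <-> eigenpoint w (B iy).
    by rewrite (Phi_ker w p2) eigenpointZ.
  have f3 : Phi P3 *m w^T = 0 <-> eigenpoint w (B ix + B iy).
    by rewrite (Phi_ker w p3) P3E eigenpointZ.
  have f4 : Phi P4 *m w^T = 0 <-> eigenpoint w (B iz).
    by rewrite (Phi_ker w p4) eigenpointZ.
  have f5 : Phi P5 *m w^T = 0 <-> eigenpoint w (B ix + B iz).
    by rewrite (Phi_ker w p5) P5E eigenpointZ.
  split=> [h|[/f1 h1 /f2 h2 /f3 h3 /f4 h4 /f5 h5]].
    have h' i (i5 : (i < 5)%N) := h (Ordinal i5).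
    split; [apply/f1|apply/f2|apply/f3|apply/f4|apply/f5];
      [have := h' 0%N isT|have := h' 1%N isT|have := h' 2%N isT|
       have := h' 3%N isT|have := h' 4%N isT]; by rewrite (tnth_nth 0).
  by case=> -[|[|[|[|[|//]]]]] i5; rewrite (tnth_nth 0).
have d1E : p * v - q * t = k * m * delta1 P1 P2 P4.
  by rewrite /p /v /q /t /delta1 /bil !mxE; ring.
have c12E : k * delta1bar P1 P2 P3 = a * cross1 p q r.
  by rewrite P3E /cross1 /p /r /q /delta1bar /bil !mxE; ring.
have c14E : m * delta1bar P1 P4 P5 = c * cross1 p t u.
  by rewrite P5E /cross1 /p /u /t /delta1bar /bil !mxE; ring.
have d2E : k * m * delta2 P1 P2 P3 P4 P5 =
   a * c * (q * (p + q) * (t + u) - t * (p + t) * (q + r)).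
  by rewrite P3E P5E /p /r /t /u /q /delta2 /bil !mxE; ring.
have km0 : k * m != 0 by rewrite mulf_neq0.
have ac0 : a * c != 0 by rewrite mulf_neq0.
have T12 := tangent23_iff a0 k0 r12 p2 B12.
have T14 := tangent23_iff c0 m0 r14 p4 B14.
rewrite -P3E in T12; rewrite -P5E in T14.
have d2z := iff_trans
  (iff_sym (scaled_eq0 km0 (erefl (k * m * delta2 P1 P2 P3 P4 P5))))
  (scaled_eq0 ac0 d2E).
have d1z := scaled_eq0 km0 d1E.
have c12z := iff_trans
  (iff_sym (scaled_eq0 k0 (erefl (k * delta1bar P1 P2 P3))))
  (scaled_eq0 a0 c12E).
have c14z := iff_trans
  (iff_sym (scaled_eq0 m0 (erefl (m * delta1bar P1 P4 P5))))
  (scaled_eq0 c0 c14E).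
by exists p, q, r, t, u, v; split.
Qed.

End Configuration.

Theorem theorem3p20 (R : realType) (P1 P2 P3 P4 P5 : 'rV[R[i]]_3)
    (hV : V_configuration P1 P2 P3 P4 P5) :
  let rk := \rank (Phi_stack [tuple P1; P2; P3; P4; P5]) in
  let cond_a := [/\ delta1 P1 P2 P4 = 0, delta1bar P1 P2 P3 = 0
                  & delta1bar P1 P4 P5 = 0] in
  let cond_b := (tangent_Qiso (join_line P1 P2) P2 \/ tangent_Qiso (join_line P1 P2) P3) /\
                (tangent_Qiso (join_line P1 P4) P4 \/ tangent_Qiso (join_line P1 P4) P5) in
  [/\ (8 <= rk <= 10)%N,
      (rk <= 9)%N <-> delta1 P1 P2 P4 * delta2 P1 P2 P3 P4 P5 = 0,
      rk = 8%N <-> cond_a \/ cond_b,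
      cond_b -> delta1 P1 P2 P4 != 0
    & cond_a \/ cond_b -> delta2 P1 P2 P3 P4 P5 = 0].
Proof.
move=> rk a b.
have [p [q [r [t [u [v [g0 rkE d1z d2z [c12z c14z T12 T14]]]]]]]] :=
  V_configuration_reduction hV.
have aE : a <-> cond_a p q r t u v.
  by split=> -[/d1z h1 /c12z h2 /c14z h3].
have bE : b <-> cond_b p q r t u by split=> -[/T12 h1 /T14 h2].
have b_d1 : b -> delta1 P1 P2 P4 != 0.
  by case/bE=> /(delta1_tangent23 g0)/eqP h _; apply/eqP => /d1z.
have d12z : (p * v - q * t) *
      (q * (p + q) * (t + u) - t * (p + t) * (q + r)) = 0 <->
    delta1 P1 P2 P4 * delta2 P1 P2 P3 P4 P5 = 0.
  split=> /eqP; rewrite mulf_eq0 => /orP[]/eqP.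
  - by move/d1z => ->; rewrite mul0r.
  - by move/d2z => ->; rewrite mulr0.
  - by move/d1z => ->; rewrite mul0r.
  - by move/d2z => ->; rewrite mulr0.
split=> //.
- by rewrite /rk rkE (leq_add2l 5 3) rank_reduced_ge3 // (leq_add2l 5 _ 5) rank_leq_row.
- by rewrite /rk rkE (leq_add2l 5 _ 4); apply: iff_trans (rank_reduced_le4 _ _ _ _ _ _) _.
- rewrite /rk rkE; split=> [/eqP|].
    by rewrite (eqn_add2l 5 _ 3) => /eqP/(rank_reduced_eq3 g0)[/aE|/bE]; [left|right].
  by move=> ab; rewrite (proj2 (rank_reduced_eq3 g0)) //; case: ab => [/aE|/bE]; [left|right].
case=> [/aE[_ c1 c2]|hb]; first by apply/d2z/cross1_delta2.
(* In case (b) the rank drops below 5, so the product of [delta1] and [delta2] vanishes, and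
   [delta1] is nonzero there. *)
have rk3 : \rank (reduced_mx p q r t u v) = 3%N.
  by apply/(rank_reduced_eq3 g0); right; apply/bE.
have : delta1 P1 P2 P4 * delta2 P1 P2 P3 P4 P5 = 0.
  by apply/d12z/rank_reduced_le4; rewrite rk3.
by move/eqP; rewrite mulf_eq0 (negPf (b_d1 hb)) => /eqP.
Qed.
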